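(* Let $I=(\mathcal{A},\mathcal{O},W)$ be an add-MARA instance and $\pi$ an allocation of $I$, and let $S$ and $S'$ be the two systems of linear inequalities associated with $\pi$ (defined in the context). Then $S$ is satisfiable if and only if $S'$ is satisfiable. Consequently, $\pi$ satisfies the CEEI test if and only if the corresponding system $S'$ is satisfiable. Moreover, in this case, giving to each object $\ell$ the price $\bar p'_\ell/\bar d$, where $\bar p'_\ell$ and $\bar d$ are the values of the variables $p'_\ell$ and $d$ in the solution of $S'$, yields a CEEI with respect to the allocation $\pi$ (that is, $\pi$ together with this price vector forms a CEEI).
   Context: An add-MARA instance is a triple $I=(\mathcal{A},\mathcal{O},W)$ where $\mathcal{A}=\{1,\dots,N\}$ is a finite set of agents, $\mathcal{O}=\{1,\dots,M\}$ is a finite set of objects, and $W:\mathcal{A}\times\mathcal{O}\to\mathbb{R}^+$ (nonnegative reals) gives the weight $W(i,\ell)$ of object $\ell$ for agent $i$. The utility of agent $i$ for a share $T\subseteq\mathcal{O}$ is $u_i(T)=\sum_{\ell\in T}W(i,\ell)$. An allocation is a vector $\pi=\langle\pi_1,\dots,\pi_N\rangle$ of pairwise disjoint (possibly empty) subsets of $\mathcal{O}$ with $\bigcup_i\pi_i=\mathcal{O}$. For a price vector $p\in[0,1]^M$, the pair $(\pi,p)$ forms a competitive equilibrium from equal incomes (CEEI) if for every agent $i$, $\pi_i\in\operatorname{argmax}_{T\subseteq\mathcal{O}}\{u_i(T):\sum_{\ell\in T}p_\ell\le 1\}$ (in particular $\sum_{\ell\in\pi_i}p_\ell\le 1$). The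 allocation $\pi$ satisfies the CEEI test if there exists $p\in[0,1]^M$ such that $(\pi,p)$ forms a CEEI. Given $\pi$, set $A_{i\ell}=1$ if $\ell\in\pi_i$ and $A_{i\ell}=0$ otherwise. Enumerate by $k=1,\dots,q$ all pairs $(i,T)$ with $i\in\mathcal{A}$, $T\subseteq\mathcal{O}$ and $u_i(T)>u_i(\pi_i)$; for the $k$-th pair $(i,T)$ set $B_{k\ell}=1$ if $\ell\in T$ and $B_{k\ell}=0$ otherwise. System $S$, in the real variables $p_1,\dots,p_M$: $0\le p_\ell\le 1$ for all $\ell\in\{1,\dots,M\}$; $\sum_{\ell=1}^M A_{i\ell}p_\ell\le 1$ for all $i\in\{1,\dots,N\}$; $\sum_{\ell=1}^M B_{k\ell}p_\ell>1$ for all $k\in\{1,\dots,q\}$. System $S'$, in the real variables $p'_1,\dots,p'_M,d$: $0\le p'_\ell$ for all $\ell\in\{1,\dots,M\}$; $\sum_{\ell=1}^M A_{i\ell}p'_\ell\le d$ for all $i\in\{1,\dots,N\}$; $\sum_{\ell=1}^M B_{k\ell}p'_\ell\ge d+1$ for all $k\in\{1,\dots,q\}$. *)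

(* Defs.v *)
From HB Require Import structures.
From mathcomp Require Import all_boot all_order all_algebra reals.

Set Implicit Arguments.
Unset Strict Implicit.
Unset Printing Implicit Defensive.

Import Order.TTheory GRing.Theory Num.Theory.
Local Open Scope ring_scope.

Record add_mara (R : realType) (N M : nat) := AddMara {
  weight : 'I_N -> 'I_M -> R;
  weight_ge0 : forall i l, 0 <= weight i l
}.

Definition utility (R : realType) (N M : nat) (inst : add_mara R N M)
    (i : 'I_N) (T : {set 'I_M}) : R :=
  \sum_(l in T) weight inst i l.

(* Shares may be empty, so several agents may hold the same (empty) share;
   this is why [finset.partition] is not used. *)
Definition is_allocation (N M : nat) (alloc : 'I_N -> {set 'I_M}) : Prop :=
  (forall i j, i != j -> [disjoint alloc i & alloc j]) /\
  \bigcup_(i < N) alloc i = [set: 'I_M].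

Definition affordable (R : realType) (M : nat) (p : 'I_M -> R) :
    {set {set 'I_M}} :=
  [set T : {set 'I_M} | \sum_(l in T) p l <= 1].

Definition demand (R : realType) (N M : nat) (inst : add_mara R N M)
    (p : 'I_M -> R) (i : 'I_N) : {set {set 'I_M}} :=
  [set T in affordable p |
    [forall T' in affordable p, utility inst i T' <= utility inst i T]].

Definition is_CEEI (R : realType) (N M : nat) (inst : add_mara R N M)
    (alloc : 'I_N -> {set 'I_M}) (p : 'I_M -> R) : Prop :=
  (forall l, 0 <= p l <= 1) /\ (forall i, alloc i \in demand inst p i).

Definition CEEI_test (R : realType) (N M : nat) (inst : add_mara R N M)
    (alloc : 'I_N -> {set 'I_M}) : Prop :=
  exists p : 'I_M -> R, is_CEEI inst alloc p.

Definition matA (R : realType) (N M : nat) (alloc : 'I_N -> {set 'I_M}) :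
    'M[R]_(N, M) :=
  \matrix_(i, l) (l \in alloc i)%:R.

Definition better_pairs (R : realType) (N M : nat) (inst : add_mara R N M)
    (alloc : 'I_N -> {set 'I_M}) : {set 'I_N * {set 'I_M}} :=
  [set iT | utility inst iT.1 (alloc iT.1) < utility inst iT.1 iT.2].

Definition matB (R : realType) (N M : nat) (inst : add_mara R N M)
    (alloc : 'I_N -> {set 'I_M}) : 'M[R]_(#|better_pairs inst alloc|, M) :=
  \matrix_(k, l) (l \in (@enum_val _ (mem (better_pairs inst alloc)) k).2)%:R.

Definition solves_S (R : realType) (N M : nat) (inst : add_mara R N M)
    (alloc : 'I_N -> {set 'I_M}) (p : 'I_M -> R) : Prop :=
  [/\ forall l, 0 <= p l <= 1,
      forall i, \sum_(l < M) matA R alloc i l * p l <= 1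
    & forall k, \sum_(l < M) matB inst alloc k l * p l > 1].

(* If d = 0 then p' = 0 and [matB] has no row (every object is allocated), so
   no agent prefers any share to its own, and p' l / d = 0 by the convention
   x / 0 = 0; hence d != 0 is not required to turn solutions into prices. *)
Definition solves_S' (R : realType) (N M : nat) (inst : add_mara R N M)
    (alloc : 'I_N -> {set 'I_M}) (p' : 'I_M -> R) (d : R) : Prop :=
  [/\ forall l, 0 <= p' l,
      forall i, \sum_(l < M) matA R alloc i l * p' l <= d
    & forall k, \sum_(l < M) matB inst alloc k l * p' l >= d + 1].

(* Main.v *)
(** [S'] is the homogenisation of [S] with denominator [d]: a solution of [S]
    whose finitely many strict inequalities all have slack at least [e > 0]
    becomes a solution of [S'] on dividing by [e] with [d = 1 / e], and
    dividing a solution of [S'] by [d] leads back to [S], the bound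
    [p' l <= d] holding because every object is allocated.  On the other hand
    [S] is a rewriting of the equilibrium condition: a share is optimal iff
    every strictly preferred one costs more than [1]. *)

Require Import Defs.
From HB Require Import structures.
From mathcomp Require Import all_boot all_order all_algebra reals.

Set Implicit Arguments.
Unset Strict Implicit.
Unset Printing Implicit Defensive.

Import Order.TTheory GRing.Theory Num.Theory.
Local Open Scope ring_scope.

(** The minimum is seeded with [1], so it stays positive when [I] is empty, as happens for [matB]
    when no agent prefers another share. *)
Lemma finite_pos_lower_bound (R : realDomainType) (I : finType) (f : I -> R) :
  (forall k, 0 < f k) -> exists2 e, 0 < e & forall k, e <= f k.
Proof.
move=> f_gt0; exists (\big[Num.min/1]_k f k).
  by apply: lt_bigmin => // k _; apply: f_gt0.
by move=> k; apply: bigmin_le.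
Qed.

Section Systems.
Variables (R : realType) (N M : nat) (inst : add_mara R N M).
Variable alloc : 'I_N -> {set 'I_M}.
Implicit Types (p : 'I_M -> R) (i : 'I_N) (T : {set 'I_M}).

Lemma sum_indicator p T :
  \sum_(l < M) (l \in T)%:R * p l = \sum_(l in T) p l.
Proof.
rewrite [RHS]big_mkcond; apply: eq_bigr => l _.
by case: ifP => _; rewrite ?mul1r ?mul0r.
Qed.

Lemma matA_price p i :
  \sum_(l < M) matA R alloc i l * p l = \sum_(l in alloc i) p l.
Proof. by rewrite -sum_indicator; apply: eq_bigr => l _; rewrite mxE. Qed.

(** Abstracting the bound as [P] lets the passage from rows to preferred shares serve both [1 < x]
    in [S] and [d + 1 <= x] in [S']. *)
Lemma matB_price p (P : R -> Prop) :
  (forall k, P (\sum_(l < M) matB inst alloc k l * p l)) <->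
  (forall i T, utility inst i (alloc i) < utility inst i T ->
     P (\sum_(l in T) p l)).
Proof.
have rowE k : \sum_(l < M) matB inst alloc k l * p l =
    \sum_(l in (@enum_val _ (mem (better_pairs inst alloc)) k).2) p l.
  by rewrite -sum_indicator; apply: eq_bigr => l _; rewrite mxE.
split=> [HB i T uT | HT k]; last first.
  by rewrite rowE; have := enum_valP k; rewrite inE; apply: HT.
have iT_better : (i, T) \in better_pairs inst alloc by rewrite inE.
by have := HB (enum_rank_in iT_better (i, T)); rewrite rowE enum_rankK_in.
Qed.

Lemma solves_S_CEEI p : solves_S inst alloc p <-> is_CEEI inst alloc p.
Proof.
split=> [[p01 HA /(matB_price p (fun x => 1 < x)) HB] | [p01 opt]].
  split=> // i; rewrite !inE -matA_price HA /=.
  apply/forall_inP => T; rewrite inE leNgt => /negP T_affordable.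
  by rewrite leNgt; apply/negP => /HB.
split=> // [i|].
  by rewrite matA_price; have := opt i; rewrite !inE => /andP[].
apply/(matB_price p (fun x => 1 < x)) => i T; rewrite !ltNge; apply: contra.
move=> T_affordable; have := opt i; rewrite !inE => /andP[_ /forall_inP].
by apply; rewrite inE.
Qed.

Lemma solves_S_to_S' p : solves_S inst alloc p ->
  exists (p' : 'I_M -> R) (d : R), solves_S' inst alloc p' d.
Proof.
move=> [p01 HA HB].
have [k|e e_gt0 He] := @finite_pos_lower_bound R _
  (fun k => \sum_(l < M) matB inst alloc k l * p l - 1).
  by rewrite subr_gt0.
exists (fun l => p l / e), e^-1.
have sumV (c : 'I_M -> R) :
    \sum_(l < M) c l * (p l / e) = (\sum_(l < M) c l * p l) / e.
  by rewrite mulr_suml; apply: eq_bigr => l _; rewrite mulrA.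
split=> [l|i|k].
- by rewrite divr_ge0 ?(ltW e_gt0) //; case/andP: (p01 l).
- by rewrite sumV ler_pdivrMr // mulVf ?gt_eqF.
- rewrite sumV ler_pdivlMr // mulrDl mulVf ?gt_eqF // mul1r.
  by have := He k; rewrite lerBrDr addrC.
Qed.

Hypothesis halloc : is_allocation alloc.

(** The owner of [l] spends at most [d] on a share whose other prices are nonnegative. This recovers
    the upper bound on prices that [S'] does not state. *)
Lemma solves_S'_price_le p' d l : solves_S' inst alloc p' d -> p' l <= d.
Proof.
move=> [p'_ge0 HA _].
have : l \in \bigcup_(i < N) alloc i by rewrite halloc.2 inE.
case/bigcupP => i _ l_i; apply: le_trans (HA i).
by rewrite matA_price (bigD1 l) //= lerDl sumr_ge0.
Qed.

Lemma solves_S'_to_S p' d : solves_S' inst alloc p' d ->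
  solves_S inst alloc (fun l => p' l / d).
Proof.
move=> S'pd; have le_d l := solves_S'_price_le l S'pd.
case: S'pd => p'_ge0 HA /(matB_price p' (fun x => d + 1 <= x)) HB.
(* The sign of [d] comes from an agent's budget: without agents there are no objects either, and [d]
   may be negative. *)
have d_ge0 i : 0 <= d.
  by apply: le_trans (HA i); rewrite matA_price sumr_ge0.
split=> [l|i|].
(* No agent is at hand here, so [0 <= d] follows from [0 <= p' l <= d]. *)
- have := le_trans (p'_ge0 l) (le_d l); rewrite le_eqVlt => /predU1P[<-|d_gt0].
    by rewrite invr0 mulr0 lexx ler01.
  by rewrite divr_ge0 ?(ltW d_gt0) //= ler_pdivrMr // mul1r.
- rewrite matA_price -mulr_suml -matA_price.
  have := d_ge0 i; rewrite le_eqVlt => /predU1P[<-|d_gt0].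
    by rewrite invr0 mulr0 ler01.
  by rewrite ler_pdivrMr // mul1r.
apply/(matB_price _ (fun x => 1 < x)) => i T /HB; rewrite -mulr_suml => T_cost.
(* If [d = 0], every price is at most [0], yet the preferred share [T] would have to cost at least
   [1]. *)
have d_gt0 : 0 < d.
  rewrite lt_neqAle (d_ge0 i) andbT; apply/eqP => d0.
  suff : \sum_(l in T) p' l <= 0.
    by move/(le_trans T_cost); rewrite -d0 add0r ler10.
  by apply: sumr_le0 => l _; rewrite [leRHS]d0.
by rewrite ltr_pdivlMr // mul1r (lt_le_trans _ T_cost) // ltrDl.
Qed.

End Systems.

Theorem proposition10 (R : realType) (N M : nat) (inst : add_mara R N M)
    (alloc : 'I_N -> {set 'I_M}) (halloc : is_allocation alloc) :
  [/\ (exists p : 'I_M -> R, solves_S inst alloc p) <->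
        (exists (p' : 'I_M -> R) (d : R), solves_S' inst alloc p' d),
      CEEI_test inst alloc <->
        (exists (p' : 'I_M -> R) (d : R), solves_S' inst alloc p' d)
    & forall (p' : 'I_M -> R) (d : R), solves_S' inst alloc p' d ->
        is_CEEI inst alloc (fun l => p' l / d)].
Proof.
have S_S' : (exists p : 'I_M -> R, solves_S inst alloc p) <->
    (exists (p' : 'I_M -> R) (d : R), solves_S' inst alloc p' d).
  split=> [[p /solves_S_to_S' //] | [p' [d /(solves_S'_to_S halloc)]]].
  by exists (fun l => p' l / d).
split=> // [|p' d /(solves_S'_to_S halloc) /solves_S_CEEI //].
by rewrite -S_S'; split=> -[p /solves_S_CEEI Hp]; exists p.
Qed.
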